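(* The minimal cardinality of a set $X\subseteq\mathbb{R}$ such that $C_p(X)$ does not have the Pytkeev property is equal to the pseudo-intersection number $\mathfrak{p}$.
   Context: For a topological space $X$, $C_p(X)$ is the set of all continuous functions $f:X\to\mathbb{R}$ with the subspace topology inherited from the Tychonoff product $\mathbb{R}^X$ (pointwise convergence). A set $X\subseteq\mathbb{R}$ carries the subspace topology. A topological space $Y$ has the Pytkeev property if for each $A\subseteq Y$ and each $y\in\overline{A}\setminus A$ there exist infinite subsets $A_1,A_2,\dots$ of $A$ such that each neighborhood of $y$ contains some $A_n$. $[\mathbb{N}]^{\aleph_0}$ is the family of infinite subsets of $\mathbb{N}$. $A\subseteq^* B$ means that $A\setminus B$ is finite. A family $\mathcal{F}\subseteq[\mathbb{N}]^{\aleph_0}$ is centered if the intersection of each nonempty finite subfamily of $\mathcal{F}$ is infinite. A pseudo-intersection of $\mathcal{F}$ is an infinite set $A\subseteq\mathbb{N}$ such that $A\subseteq^* B$ for all $B\in\mathcal{F}$. $\mathfrak{p}$ is the minimal cardinality of a centered family in $[\mathbb{N}]^{\aleph_0}$ which has no pseudo-intersection. *)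

(* Defs.v *)
From HB Require Import structures.
From mathcomp Require Import all_boot all_order all_algebra.
From mathcomp Require Import all_classical all_reals all_analysis.

Set Implicit Arguments.
Unset Strict Implicit.
Unset Printing Implicit Defensive.

Import Order.TTheory GRing.Theory Num.Theory.
Import numFieldNormedType.Exports.

Local Open Scope classical_set_scope.
Local Open Scope card_scope.

Definition pytkeev (Y : topologicalType) : Prop :=
  forall (A : set Y) (y : Y), (closure A `\` A) y ->
    exists B : nat -> set Y,
      (forall n, B n `<=` A /\ infinite_set (B n)) /\
      (forall U, nbhs y U -> exists n, B n `<=` U).

(* A set coerces to the subtype of its elements, which the library endows with
   the subspace topology.  This happens twice here: the outer set is a subset
   of the Tychonoff product {ptws X -> R}, and, for [X : set R] used as a space,
   [continuous] refers to the subspace topology of X. *)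
Definition Cp (X : topologicalType) (R : realType) : topologicalType :=
  set_type [set f : {ptws X -> R} | continuous (f : X -> R)].

Definition almost_subset (A B : set nat) : Prop := finite_set (A `\` B).

Definition centered (F : set (set nat)) : Prop :=
  (forall B, F B -> infinite_set B) /\
  (forall G, G `<=` F -> finite_set G -> G !=set0 ->
    infinite_set (\bigcap_(B in G) B)).

Definition pseudo_intersection (F : set (set nat)) (A : set nat) : Prop :=
  infinite_set A /\ forall B, F B -> almost_subset A B.

(* [A] realizes the minimal cardinality of a set satisfying [P].  Such a set
   represents a cardinal number: any two of them are equipotent. *)
Definition realizes_min_card (T : Type) (P : set T -> Prop) (A : set T) : Prop :=
  P A /\ forall B, P B -> A #<= B.

(* The cardinality of [F] is the pseudo-intersection number. *)
Definition realizes_pseudo_intersection_number (F : set (set nat)) : Prop :=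
  realizes_min_card
    (fun G => centered G /\ ~ exists A, pseudo_intersection G A) F.

(* Main.v *)
(* A countable pseudobase of a family E : I -> set nat is a sequence of infinite
   sets A_k such that every finite intersection of members of E contains some
   A_k.  Suppose that every centered family indexed by I has one.
   - Every chain (T_i) for almost inclusion has a pseudo-intersection: if no A_k
     is one, choose T_{t k} not almost containing A_k.  No T_i lies below all
     the T_{t k}, because T_i contains some A_k; so the T_{t k} are coinitial,
     and a countable chain is diagonalized.
   - Every family (f_i) of functions is eventually bounded by one g: build by
     transfinite recursion a chain (T_i) so sparse that any infinite subset of
     T_i bounds f_i; the countably many functions read off a pseudobase of (T_i)
     bound all the f_i.
   - Let (B_i) be centered.  By a refinement of the first argument, using the
     second to diagonalize, a chain of sets which meet every finite intersection
     of (B_i) in an infinite set has a pseudo-intersection of the same kind.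
     Transfinite recursion gives such a chain with T_i included in B_i, and a
     pseudo-intersection of (T_i) is one of (B_i).
   Hence a family F realizing p indexes a centered family E without countable
   pseudobase.  Code the E_i by reals; the locally constant functions equal to
   1/(n+2) on the codes of sets containing n and to 1 + 1/(n+2) elsewhere
   accumulate at 0, and the Pytkeev property at 0 would yield a pseudobase of E.
   Conversely, C_p(Z) is countably tight, so a point y of the closure of A is in
   the closure of a sequence (g_n) in A.  A pseudo-intersection of sets of
   indices at which g_n(x) is close to y(x), for x in Z, gives a sequence in A
   converging to y, whose tails witness the Pytkeev property at y. *)
Require Import Defs.
From HB Require Import structures.
From mathcomp Require Import all_boot all_order all_algebra.
From mathcomp Require Import all_classical all_reals all_analysis.
From mathcomp Require wochoice.
From mathcomp Require Import lra.
Import numFieldNormedType.Exports.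
Import Order.TTheory GRing.Theory Num.Theory.

Set Implicit Arguments.
Unset Strict Implicit.
Unset Printing Implicit Defensive.

Local Open Scope classical_set_scope.
Local Open Scope card_scope.

(** * Almost inclusion and chains *)

Lemma bigcap_cons (I : eqType) (T : Type) (E : I -> set T) (x : I) (s : seq I) :
  \bigcap_(i in [set` x :: s]) E i = E x `&` \bigcap_(i in [set` s]) E i.
Proof.
rewrite -bigcap_setU1; congr (\bigcap_(i in _) _).
by apply/seteqP; split=> i /=; rewrite inE => /predU1P.
Qed.

Lemma infinite_natP (A : set nat) :
  infinite_set A <-> forall n, exists2 m, n <= m & A m.
Proof.
split=> [infA n|unbA finA].
  apply: contrapT => noA; apply: infA; apply: (@sub_finite_set _ _ `I_n).
    move=> m Am /=; rewrite ltnNge; apply/negP => nm.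
    by apply: noA; exists m.
  exact: finite_II.
have /finite_seqP[s As] := finA.
have [m + Am] := unbA (\max_(i <- s) i).+1.
rewrite ltnNge => /negP; apply.
by move: Am; rewrite As /= => ms; rewrite (big_rem m ms) leq_maxl.
Qed.

Lemma almost_subsetP (A B : set nat) :
  almost_subset A B <-> exists N, forall n, N <= n -> A n -> B n.
Proof.
split=> [finAB|[N AB]].
  apply: contrapT => noN; suff: infinite_set (A `\` B) by [].
  apply/infinite_natP => n; apply: contrapT => nom; apply: noN.
  exists n => m nm Am; apply: contrapT => nBm; apply: nom.
  by exists m.
apply: (@sub_finite_set _ _ `I_N); last exact: finite_II.
move=> n [An nBn] /=; rewrite ltnNge; apply/negP => Nn; exact/nBn/AB.
Qed.

Lemma subset_almost (A B : set nat) : A `<=` B -> almost_subset A B.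
Proof. by move=> AB; apply/almost_subsetP; exists 0 => n _ /AB. Qed.

Lemma almost_subset_trans (A B C : set nat) :
  almost_subset A B -> almost_subset B C -> almost_subset A C.
Proof.
move=> /almost_subsetP[N AB] /almost_subsetP[M BC].
apply/almost_subsetP; exists (maxn N M) => n.
by rewrite geq_max => /andP[Nn Mn] /(AB _ Nn)/(BC _ Mn).
Qed.

Lemma almost_subsetI (A B C : set nat) :
  almost_subset A B -> almost_subset A C -> almost_subset A (B `&` C).
Proof.
move=> /almost_subsetP[N AB] /almost_subsetP[M AC].
apply/almost_subsetP; exists (maxn N M) => n.
by rewrite geq_max => /andP[Nn Mn] An; split; [exact: AB Nn An|exact: AC Mn An].
Qed.

Lemma infinite_almost (A B : set nat) :
  infinite_set A -> almost_subset A B -> infinite_set B.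
Proof.
move=> /infinite_natP infA /almost_subsetP[N AB]; apply/infinite_natP => n.
have [m + Am] := infA (maxn n N); rewrite geq_max => /andP[nm Nm].
by exists m => //; exact: AB Nm Am.
Qed.

Lemma leq_bigmax_ltn (f : nat -> nat) (m n : nat) :
  m < n -> f m <= \max_(i < n) f i.
Proof.
by move=> mn; exact: (leq_bigmax (F := fun i : 'I_n => f i) (Ordinal mn)).
Qed.

(* The cardinality of J is less than the bounding number. *)
Definition all_bounded (J : Type) : Prop := forall f : J -> nat -> nat,
  exists g, forall j, exists N, forall n, N <= n -> f j n <= g n.

Lemma countable_bounded (f : nat -> nat -> nat) :
  exists g, forall k n, k <= n -> f k n <= g n.
Proof.
exists (fun n => \max_(i < n.+1) f i n) => k n; rewrite -ltnS => kn.
exact: (leq_bigmax_ltn (f^~ n) kn).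
Qed.

Lemma all_bounded_unit : all_bounded unit.
Proof. by move=> f; exists (f tt) => -[]; exists 0. Qed.


(** Induction on the length bounds the sequences of each fixed length; these countably many bounds
    are then merged into one. *)
Lemma all_bounded_seq (J : Type) : all_bounded J -> all_bounded (seq J).
Proof.
move=> bJ f0.
have bk k : forall f : seq J -> nat -> nat, exists g, forall s, size s = k ->
    exists N, forall n, N <= n -> f s n <= g n.
  elim: k => [f|k IHk f].
    by exists (f [::]) => s /size0nil ->; exists 0.
  have /choice[G GP] x := IHk (fun s => f (x :: s)).
  have [g gP] := bJ G.
  exists g => -[//|x s] [/(GP x)[N fG]]; have [M Gg] := gP x.
  exists (maxn N M) => n; rewrite geq_max => /andP[Nn Mn].
  exact: leq_trans (fG n Nn) (Gg n Mn).
have /choice[G GP] k := bk k f0.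
have [g gP] := countable_bounded G.
exists g => s; have [N fG] := GP _ s erefl.
exists (maxn N (size s)) => n; rewrite geq_max => /andP[Nn Mn].
exact: leq_trans (fG n Nn) (gP _ _ Mn).
Qed.

(** Let [f j n] be a point of [U n] and [C j] from [n] on, and let [g] bound all the [f j]. The
    union of the finite pieces of [U n] between [n] and [g n] contains [f j n] for all large [n]. *)
Lemma diagonal_pseudo_intersection (J : Type) (U : nat -> set nat)
    (C : J -> set nat) :
  all_bounded J -> (forall n, U n.+1 `<=` U n) ->
  (forall j n, infinite_set (U n `&` C j)) ->
  exists P, (forall n, almost_subset P (U n)) /\
            forall j, infinite_set (P `&` C j).
Proof.
move=> bJ Udec UC.
have Uanti m n : m <= n -> U n `<=` U m.
  elim: n => [|n IHn]; first by rewrite leqn0 => /eqP->.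
  by rewrite leq_eqVlt => /predU1P[->//|/IHn]; exact: subset_trans.
have /choice[f fP] j : exists f : nat -> nat, forall n,
    n <= f n /\ (U n `&` C j) (f n).
  have /choice[f fP] n : exists m, n <= m /\ (U n `&` C j) m.
    by have /infinite_natP/(_ n)[m] := UC j n; exists m.
  by exists f.
have [g gP] := bJ f.
exists [set m | exists2 n, n <= m <= g n & U n m]; split=> [k|j].
  apply/almost_subsetP; exists (\max_(i < k) g i).+1 => m km.
  move=> [n /andP[nm mg] Unm]; have [nk|kn] := ltnP n k; last exact: Uanti Unm.
  by have := leq_trans km (leq_trans mg (leq_bigmax_ltn g nk)); rewrite ltnn.
have [N fg] := gP j.
apply/infinite_natP => n; exists (f j (maxn n N)).
  by apply: leq_trans (leq_maxl n N) _; have [] := fP j (maxn n N).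
have [le_f [Uf Cf]] := fP j (maxn n N); split=> //.
by exists (maxn n N); rewrite // le_f fg ?leq_maxr.
Qed.

Definition almost_chain (I : Type) (D : set I) (T : I -> set nat) : Prop :=
  forall i j, D i -> D j ->
    almost_subset (T i) (T j) \/ almost_subset (T j) (T i).

(** Along a chain, each finite intersection [U n] almost includes one of the [T (t k)], so it still
    meets every [C j] in an infinite set and the [U n] can be diagonalized. *)
Lemma coinitial_pseudo_intersection (I J : Type) (D : set I) (T : I -> set nat)
    (C : J -> set nat) (t : nat -> I) :
  all_bounded J -> almost_chain D T ->
  (forall i j, D i -> infinite_set (T i `&` C j)) ->
  (forall k, D (t k)) ->
  (forall i, D i -> exists k, almost_subset (T (t k)) (T i)) ->
  exists P, (forall i, D i -> almost_subset P (T i)) /\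
            forall j, infinite_set (P `&` C j).
Proof.
move=> bJ Tch TC Dt tT.
pose U n := [set m | forall k, k <= n -> T (t k) m].
have UT n : exists2 k, k <= n & almost_subset (T (t k)) (U n).
  elim: n => [|n [k kn TU]].
    exists 0 => //; apply: subset_almost => m Tm k.
    by rewrite leqn0 => /eqP ->.
  have US : U n `&` T (t n.+1) `<=` U n.+1.
    move=> m [Um Tm] j; rewrite leq_eqVlt => /predU1P[->//|]; exact: Um.
  have [TT|TT] := Tch _ _ (Dt k) (Dt n.+1).
    exists k; first exact: leqW.
    by apply: almost_subset_trans (subset_almost US); exact: almost_subsetI.
  exists n.+1 => //; apply: almost_subset_trans (subset_almost US).
  apply: almost_subsetI; last exact: subset_almost.
  exact: almost_subset_trans TU.
have [||P [PU PC]] := @diagonal_pseudo_intersection _ U C bJ.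
- by move=> n m Um k kn; apply: Um; exact: leqW.
- move=> j n; have [k _ TU] := UT n.
  apply: infinite_almost (TC (t k) j (Dt k)) _.
  apply: almost_subsetI; last by apply: subset_almost => ? [].
  by apply: almost_subset_trans TU; apply: subset_almost => ? [].
exists P; split=> // i /tT[k]; apply: almost_subset_trans.
apply: almost_subset_trans (PU k) _; apply: subset_almost => m.
exact.
Qed.

(** * Centered families, pseudobases and lower bounds of chains *)

Definition centered_family (I : choiceType) (E : I -> set nat) : Prop :=
  forall s : seq I, infinite_set (\bigcap_(i in [set` s]) E i).

Definition countable_pseudobase (I : choiceType) (E : I -> set nat) : Prop :=
  exists A : nat -> set nat, (forall k, infinite_set (A k)) /\
    forall s : seq I, exists k, A k `<=` \bigcap_(i in [set` s]) E i.

Definition all_pseudobased (I : choiceType) : Prop :=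
  forall E : I -> set nat, centered_family E -> countable_pseudobase E.

Section Chains.
Variables (I : choiceType).
Hypothesis pbI : all_pseudobased I.

(** Merge chain and family into one family [E] and take a pseudobase [A] of it. Either the [A k]
    below the whole chain suffice for the finite intersections of [B], or sets of the chain
    witnessing that the other [A k] are not below it are coinitial. *)
Lemma chain_coinitial_or_lower_bounds (D : set I) (T B : I -> set nat) :
  D !=set0 -> almost_chain D T ->
  (forall i (s : seq I), D i ->
     infinite_set (T i `&` \bigcap_(j in [set` s]) B j)) ->
  (exists t : nat -> I, (forall k, D (t k)) /\
     forall i, D i -> exists k, almost_subset (T (t k)) (T i)) \/
  (exists A : nat -> set nat,
     (forall k, infinite_set (A k) /\
        forall i, D i -> almost_subset (A k) (T i)) /\
     forall s : seq I, exists k, A k `<=` \bigcap_(j in [set` s]) B j).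
Proof.
move=> [d Dd] Tch TB.
pose E i := if `[< D i >] then T i `&` B i else B i.
(* One set of the chain is almost included in all those involved in [s]; this makes [E] centered. *)
have Emin (s : seq I) : exists2 i, D i &
    almost_subset (T i `&` \bigcap_(j in [set` s]) B j)
                  (\bigcap_(j in [set` s]) E j).
  have [i Di iP] : exists2 i, D i &
      almost_subset (T i) [set m | forall j, j \in s -> D j -> T j m].
    elim: s => [|x s [i Di iT]].
      by exists d => //; apply: subset_almost => m _ j.
    have [Dx|nDx] := pselect (D x); last first.
      exists i => //; apply: almost_subset_trans iT _; apply: subset_almost.
      move=> m Tm j; rewrite inE => /predU1P[->//|]; exact: Tm.
    have Ts : T x `&` [set m | forall j, j \in s -> D j -> T j m] `<=`
        [set m | forall j, j \in x :: s -> D j -> T j m].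
      by move=> m [Txm Tm] j; rewrite inE => /predU1P[->//|]; exact: Tm.
    have [TT|TT] := Tch _ _ Dx Di.
      exists x => //; apply: almost_subset_trans (subset_almost Ts).
      apply: almost_subsetI; first exact: subset_almost.
      exact: almost_subset_trans iT.
    exists i => //; apply: almost_subset_trans (subset_almost Ts).
    exact: almost_subsetI.
  exists i => //; have /almost_subsetP[N iN] := iP.
  apply/almost_subsetP; exists N => n Nn [Tn Bn] j /= js; rewrite /E.
  by case: asboolP => [Dj|_]; [split; [exact: iN|]|]; exact: Bn.
have [|A [Ainf AE]] := pbI (E := E).
  move=> s; have [i Di] := Emin s; apply: infinite_almost; exact: TB.
have EB (s : seq I) :
    \bigcap_(j in [set` s]) E j `<=` \bigcap_(j in [set` s]) B j.
  by move=> m Em j js; have := Em j js; rewrite /E; case: ifP => // _ [].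
pose K := [set k | forall i, D i -> almost_subset (A k) (T i)].
have [KB|/existsNP[s0 s0P]] := pselect (forall s : seq I, exists2 k, K k &
    A k `<=` \bigcap_(j in [set` s]) B j).
  right; have [k0 Kk0 _] := KB [::].
  exists (fun k => if `[< K k >] then A k else A k0); split=> [k|s].
    by case: asboolP => [Kk|_]; split.
  have [k Kk kB] := KB s; exists k.
  by case: asboolP.
left.
have /choice[t tP] k : exists i, D i /\
    (A k `<=` \bigcap_(j in [set` s0]) B j ->
    ~ almost_subset (A k) (T i)).
  have [kB|nkB] := pselect (A k `<=` \bigcap_(j in [set` s0]) B j); last first.
    by exists d.
  apply: contrapT => noi; apply: s0P; exists k => // i Di.
  by apply: contrapT => nAT; apply: noi; exists i.
exists t; split=> [k|i Di]; first by have [] := tP k.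
apply: contrapT => noT.
(* This [A k] lies in [T i]; were [T i] almost included in [T (t k)], so would be [A k], against the
   choice of [t k]. *)
have [k kE] := AE (i :: s0).
have [Dt /(_ _)[]] := tP k.
  move=> m /kE Em j js; apply: (EB (i :: s0)) => //=.
  by rewrite inE [_ \in _]js orbT.
apply: (@almost_subset_trans _ (T i)).
  apply: subset_almost => m /kE/(_ i); rewrite /= inE eqxx /E => /(_ isT).
  by case: asboolP => // _ [].
have [//|TT] := Tch _ _ Di Dt.
by exfalso; apply: noT; exists k.
Qed.

Lemma chain_pseudo_intersection (D : set I) (T : I -> set nat) :
  almost_chain D T -> (forall i, D i -> infinite_set (T i)) ->
  exists P, infinite_set P /\ forall i, D i -> almost_subset P (T i).
Proof.
move=> Tch Tinf; have [->|/set0P D0] := eqVneq D set0.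
  by exists setT; split=> //; exact: infinite_nat.
have Tpos i (s : seq I) : D i ->
    infinite_set (T i `&` \bigcap_(j in [set` s]) (fun=> setT) j).
  move=> Di; rewrite bigcapT // setIT; exact: Tinf.
have [[t [Dt tT]]|[A [AP _]]] := chain_coinitial_or_lower_bounds D0 Tch Tpos.
  have [|P [PT PC]] := @coinitial_pseudo_intersection _ _ D T (fun=> setT) t
    all_bounded_unit Tch _ Dt tT.
    by move=> i j Di; rewrite setIT; exact: Tinf.
  by exists P; split=> //; have := PC tt; rewrite setIT.
by exists (A 0); have [] := AP 0.
Qed.

(** Without a coinitial sequence, [P] is the union of the [A k] cut off below [g k], where [g]
    bounds the functions [f i] giving the point from which [A k] lies in [T i]. The finitely many
    [k] at which [g] is below [f i] are harmless. *)
Lemma chain_positive_lower_bound (D : set I) (T B : I -> set nat) :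
  all_bounded I -> almost_chain D T -> centered_family B ->
  (forall i (s : seq I), D i ->
     infinite_set (T i `&` \bigcap_(j in [set` s]) B j)) ->
  exists P,
    (forall s : seq I, infinite_set (P `&` \bigcap_(j in [set` s]) B j)) /\
            forall i, D i -> almost_subset P (T i).
Proof.
move=> bI Tch Bc TB; have [->|/set0P D0] := eqVneq D set0.
  by exists setT; split=> // s; rewrite setTI; exact: Bc.
have [[t [Dt tT]]|[A [AP AB]]] := chain_coinitial_or_lower_bounds D0 Tch TB.
  have [P [PT PB]] := @coinitial_pseudo_intersection _ (seq I) D T
    (fun s => \bigcap_(j in [set` s]) B j) t (all_bounded_seq bI) Tch TB Dt tT.
  by exists P.
have /choice[f fP] i : exists f : nat -> nat, D i -> forall k n,
    f k <= n -> A k n -> T i n.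
  have [Di|nDi] := pselect (D i); last by exists id.
  have /choice[f fP] k : exists N, forall n, N <= n -> A k n -> T i n.
    by apply/almost_subsetP; have [_] := AP k; apply.
  by exists f.
have [g gP] := bI f.
exists [set n | exists2 k, g k <= n & A k n]; split=> [s|i Di].
  have [k kB] := AB s; apply/infinite_natP => n.
  have [/infinite_natP/(_ (maxn n (g k)))[m + Am] _] := AP k.
  rewrite geq_max => /andP[nm gm]; exists m => //.
  by split; [exists k|exact: kB].
have [N fg] := gP i.
apply/almost_subsetP; exists (\max_(k < N) f i k) => n maxn [k gn Akn].
apply: fP Akn => //; have [kN|Nk] := ltnP k N.
  exact: leq_trans (leq_bigmax_ltn (f i) kN) maxn.
exact: leq_trans (fg k Nk) gn.
Qed.

End Chains.

(** * Towers by transfinite recursion *)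

Lemma well_founded_total (I : eqType) : exists lt : I -> I -> Prop,
  well_founded lt /\ forall i j, lt i j \/ i = j \/ lt j i.
Proof.
have [R Rwo] := wochoice.well_ordering_principle I.
exists (fun i j => ~~ R j i); split=> [i|i j].
  apply: contrapT => nAi.
  have [|z [[nAz zmin] _]] :=
      Rwo (fun i => `[< ~ Acc (fun i j => ~~ R j i) i >]).
    by exists i; apply/asboolP.
  move: nAz => /asboolP; apply; split=> j; apply: contraNP => nAj.
  by apply: zmin; apply/asboolP.
have [Rij|] := boolP (R i j); last by right; right.
have [Rji|] := boolP (R j i); last by left.
have Ranti := wochoice.wo_chain_antisymmetric
  (wochoice.withinW (A := predT) Rwo).
right; left.
by apply: Ranti => //; rewrite Rij Rji.
Qed.

(** [T i] is chosen below all earlier sets. By induction these form a chain, so the hypothesis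
    provides a candidate and [get] does not fall back on a default. *)
Lemma tower_recursion (I : eqType) (lt : I -> I -> Prop)
    (Pos : set nat -> Prop) (Q : I -> set nat -> Prop) :
  well_founded lt -> (forall i j, lt i j \/ i = j \/ lt j i) ->
  (forall i T, (forall j, lt j i -> Pos (T j)) ->
     almost_chain (lt^~ i) T ->
     exists P, [/\ Pos P, Q i P & forall j, lt j i -> almost_subset P (T j)]) ->
  exists T, almost_chain setT T /\ forall i, Pos (T i) /\ Q i (T i).
Proof.
move=> wf tri step.
pose F i (T : forall j, lt j i -> set nat) : set nat :=
  get [set P | [/\ Pos P, Q i P & forall j h, almost_subset P (T j h)]].
pose T := Fix wf (fun=> set nat) F.
have TE i : T i = F i (fun j _ => T j).
  apply: Fix_eq => j f g fg.
  by congr F; do 2![apply: functional_extensionality_dep => ?].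
pose next i := [set P |
  [/\ Pos P, Q i P & forall j, lt j i -> almost_subset P (T j)]].
have TP i : next i (T i).
  elim/(well_founded_ind wf): i => i IHi.
  rewrite [T i]TE; apply: (@getPex _ (next i)).
  apply: step => [j /IHi[]//|j k ji ki].
  have [jk|[->|kj]] := tri j k.
  - by right; have [_ _] := IHi k ki; apply.
  - by left; exact: subset_almost.
  - by left; have [_ _] := IHi j ji; apply.
exists T; split=> [i j _ _|i]; last by have [] := TP i.
have [ij|[->|ji]] := tri i j.
- by right; have [_ _] := TP j; apply.
- by left; exact: subset_almost.
- by left; have [_ _] := TP i; apply.
Qed.

(** Equivalently, [P] has at most one point in each interval from [n] to [f n] excluded. The bound
    is on the second point since the first may be [n] itself. *)
Definition sparse (f : nat -> nat) (P : set nat) : Prop :=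
  forall n a b, P a -> P b -> n <= a -> a < b -> f n <= b.

Lemma sparse_subset (f : nat -> nat) (P : set nat) :
  infinite_set P -> exists Q, [/\ Q `<=` P, infinite_set Q & sparse f Q].
Proof.
move=> /infinite_natP Pinf.
have /choice[h hP] x : exists y, [/\ P y, x < y & forall n, n <= x -> f n <= y].
  have [y + Py] := Pinf (maxn x.+1 (\max_(i < x.+1) f i)).
  rewrite geq_max => /andP[xy fy]; exists y; split=> // n nx.
  exact: leq_trans (leq_bigmax_ltn f (nx : n < x.+1)) fy.
(* Starting from [h 0] rather than 0 keeps all values in [P]. *)
pose p k := iter k.+1 h 0.
have pS k : p k.+1 = h (p k) by [].
have pinc i j : i < j -> p i < p j.
  elim: j => // j IHj; rewrite ltnS leq_eqVlt => /predU1P[->|/IHj ij].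
    by rewrite pS; have [] := hP (p j).
  by apply: ltn_trans ij _; rewrite pS; have [] := hP (p j).
exists (range p); split=> [_ [k _ <-]||n _ _ [i _ <-] [j _ <-] nip ij].
- by have [] := hP (iter k h 0).
- apply/infinite_natP => n; exists (p n); last by exists n.
  by elim: n => // n IHn; apply: leq_ltn_trans IHn _; exact: pinc.
- have {}ij : i < j.
    rewrite ltnNge; apply: contraTN ij.
    by rewrite leq_eqVlt -leqNgt => /predU1P[->//|/pinc/ltnW].
  have [_ _ /(_ n nip) fp] := hP (p i); apply: leq_trans fp _; rewrite -pS.
  by move: ij; rewrite leq_eqVlt => /predU1P[->//|/pinc/ltnW].
Qed.

Lemma all_pseudobased_bounded (I : choiceType) :
  all_pseudobased I -> all_bounded I.
Proof.
move=> pbI f.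
have [lt [wf tri]] := well_founded_total I.
have [i T Tinf Tch|T [Tch TP]] := @tower_recursion I lt
  (fun P => infinite_set P) (fun i P => sparse (f i) P) wf tri.
  have [P [Pinf PT]] := chain_pseudo_intersection pbI Tch Tinf.
  have [Q [QP Qinf Qf]] := sparse_subset (f i) Pinf.
  exists Q; split=> // j ji.
  exact: almost_subset_trans (subset_almost QP) (PT j ji).
have [s|A [Ainf AT]] := @pbI T.
  have [i iP] : exists P, infinite_set P /\
      forall i, setT i -> almost_subset P (T i).
    by apply: (chain_pseudo_intersection pbI Tch) => i _; have [] := TP i.
  apply: infinite_almost iP.1 _; elim: s => [|x s IHs].
    by apply: subset_almost => m _ j.
  apply: almost_subset_trans (almost_subsetI (iP.2 x Logic.I) IHs) _.
  apply: subset_almost => m [Tx Ts] j /=; rewrite inE => /predU1P[->//|].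
  exact: Ts.
(* [g k n] is preceded in [A k] by another point from [n] on, so it is at least [f i n] once [A k]
   lies in the sparse set [T i]. *)
have /choice[g gP] k : exists g : nat -> nat, forall n,
    exists a, [/\ A k a, A k (g n), n <= a & a < g n].
  have /choice[g gP] n : exists b a, [/\ A k a, A k b, n <= a & a < b].
    have /infinite_natP Ak := Ainf k; have [a na Aa] := Ak n.
    by have [b ab Ab] := Ak a.+1; exists b, a.
  by exists g.
have [G GP] := countable_bounded g.
exists G => i; have [k kT] := AT [:: i].
have AkT : A k `<=` T i by move=> m /kT/(_ i); apply; rewrite /= inE.
exists k => n kn; apply: leq_trans (GP k n kn).
have [a [Aa Ag na ag]] := gP k n; have [_ fT] := TP i.
exact: fT (AkT _ Aa) (AkT _ Ag) na ag.
Qed.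

Lemma all_pseudobased_pseudo_intersection (I : choiceType) (B : I -> set nat) :
  all_pseudobased I -> centered_family B ->
  exists P, infinite_set P /\ forall i, almost_subset P (B i).
Proof.
move=> pbI Bc; have bI := all_pseudobased_bounded pbI.
have [lt [wf tri]] := well_founded_total I.
have [i T TB Tch|T [Tch TP]] := @tower_recursion I lt
    (fun P => forall s : seq I,
       infinite_set (P `&` \bigcap_(j in [set` s]) B j))
    (fun i P => P `<=` B i) wf tri.
  have [|P [PB PT]] := chain_positive_lower_bound pbI bI Tch Bc.
    by move=> j s ji; exact: TB.
  (* Positivity survives the cut with [B i], because any [s] can be extended by [i]. *)
  exists (P `&` B i); split=> [s||j ji]; [|by move=> m []|].
    have := PB (i :: s); apply: contra_not; apply: sub_finite_set => m [Pm Bm].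
    split; first by split=> //; apply: Bm; rewrite /= inE eqxx.
    by move=> j /= js; apply: Bm; rewrite /= inE [_ \in _]js orbT.
  by apply: almost_subset_trans (PT j ji); apply: subset_almost => m [].
have [|P [Pinf PT]] := chain_pseudo_intersection pbI Tch.
  move=> i _; have [/(_ [::])+ _] := TP i; apply: contra_not.
  by apply: sub_finite_set => m [].
exists P; split=> // i; apply: almost_subset_trans (PT i Logic.I) _.
by apply: subset_almost; have [] := TP i.
Qed.

(** * Minimal cardinalities and centered families *)

(* Hoenig's argument: order by inclusion the sets of choice functions on P any
   two of which differ everywhere; at a maximal one, some projection is onto. *)
Lemma min_card_exists (T : Type) (P : set T -> Prop) :
  (exists A, P A) -> exists A, realizes_min_card P A.
Proof.
move=> [A0 PA0]; pose J := {A : set T | P A}.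
pose transversals (Phi : set (J -> T)) :=
  (forall t j, Phi t -> sval j (t j)) /\
  (forall t u j, Phi t -> Phi u -> t j = u j -> t = u).
have [|Phi [[PhiP Phiinj] Phimax]] := @Zorn_bigcup _ transversals.
  move=> F FP Ftot; split=> [t j [Phi /FP[PhiP _]]|t u j [X FX Xt] [Y FY Yu]].
    exact: PhiP.
  have [XY|YX] := Ftot _ _ FX FY.
    by apply: (FP _ FY).2 => //; exact: XY.
  by apply: (FP _ FX).2 => //; exact: YX.
have [j jsurj] : exists j : J, sval j `<=` (fun t => t j) @` Phi.
  apply: contrapT => /forallNP nsurj.
  have /choice[t0 t0P] : forall j : J, exists x, sval j x /\
      ~ ((fun t => t j) @` Phi) x.
    move=> j; have /existsNP[x /not_implyP[jx nx]] := nsurj j.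
    by exists x.
  apply: (Phimax (Phi `|` [set t0])).
    split; first by move=> t; left.
    move=> sub; have [_] := t0P (exist _ A0 PA0); apply.
    by exists t0 => //; apply: sub; right.
  split=> [t j [/PhiP//|->]|]; first by have [] := t0P j.
  move=> t u j [Pt|->] [Pu|->] // tu; first exact: Phiinj tu.
    by have [_ []] := t0P j; exists t.
  by have [_ []] := t0P j; exists u.
exists (sval j); split; first exact: (svalP j).
(* [Phi] projects onto [sval j] and injectively into [B]. *)
move=> B PB; pose k : J := exist _ B PB.
apply: card_le_trans (subset_card_le jsurj) _.
apply: card_le_trans (card_image_le _ _) _.
apply: (@card_le_trans _ _ _ ((fun t => t k) @` Phi)).
  suff /card_eqPle[] : (fun t => t k) @` Phi #= Phi by [].
  by apply: inj_card_eq => t u /set_mem Pt /set_mem Pu; exact: Phiinj.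
by apply: subset_card_le => _ [t Pt <-]; exact: (PhiP _ k Pt).
Qed.


(** A free ultrafilter works: halve an infinite [A] into infinite parts. One half or its complement
    is in the ultrafilter, and neither almost includes [A]. *)
Lemma no_pseudo_intersection_exists :
  exists F, centered F /\ ~ exists A, pseudo_intersection F A.
Proof.
have [U [UU ooU]] := ultraFilterLemma eventually_filter.
have Uinf B : U B -> infinite_set B.
  move=> UB; apply/infinite_natP => n.
  have : U [set m | n <= m] by apply: ooU; exists n.
  by move=> /(filterI UB)/filter_ex[m [Bm nm]]; exists m.
exists U; split.
  split=> // G GU /finite_seqP[s Gs] _; apply: Uinf.
  rewrite Gs in GU *; elim: s {Gs} GU => [|B s IHs] GU.
    by rewrite set_nil bigcap_set0; exact: filterT.
  rewrite bigcap_cons; apply: filterI; first by apply: GU; rewrite /= inE eqxx.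
  by apply: IHs => C Cs; apply: GU; rewrite /= inE [_ \in _]Cs orbT.
move=> [A [/infiniteP/pcard_leP/unsquash f AU]].
have infA (b : bool) : infinite_set [set f n | n in [set n | odd n = b]].
  apply/infiniteP; apply: (@card_le_trans _ _ _ [set n | odd n = b]).
    apply/infiniteP/infinite_natP => n; exists (n.*2 + b).
      by rewrite -addnn -addnA leq_addr.
    by rewrite /= oddD odd_double; case: b.
  suff /card_eqPle[] : f @` [set n | odd n = b] #= [set n | odd n = b] by [].
  by apply: inj_card_eq => i j _ _; apply: inj; rewrite inE.
pose A1 := [set f n | n in [set n | odd n = true]].
have A1A0 : [set f n | n in [set n | odd n = false]] `<=` A `\` A1.
  move=> _ [n /= on <-]; split; first exact: funS.
  by move=> [m /= om] /inj; rewrite !inE => /(_ I I) mn; rewrite mn on in om.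
have A1A : A1 `<=` A `\` ~` A1.
  move=> _ [n /= on <-]; split; [exact: funS|by apply; exists n].
have [/AU|/AU] := in_ultra_setVsetC A1 UU.
  by move=> /(sub_finite_set A1A0); exact: infA.
by move=> /(sub_finite_set A1A); exact: infA.
Qed.

Lemma centered_family_set (F : set (set nat)) :
  centered F -> centered_family (fun B : F => set_val B).
Proof.
move=> [_ Fc] [|B s].
  by rewrite set_nil bigcap_set0; exact: infinite_nat.
have := Fc [set set_val C | C in [set` B :: s]]; rewrite bigcap_image; apply.
- by move=> _ [C _ <-]; exact: set_valP.
- exact: finite_image (finite_seq _).
- by exists (set_val B), B => //=; rewrite inE eqxx.
Qed.

Lemma centered_range (I : choiceType) (E : I -> set nat) :
  centered_family E -> centered (range E).
Proof.
move=> Ec; split=> [_ [i _ <-]|G GE /finite_seqP[s Gs] [B GB]].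
  by have := Ec [:: i]; rewrite set_cons1 bigcap_set1.
have [i0 _ _] := GE _ GB.
have /choice[h hP] C : exists i, G C -> E i = C.
  by have [/GE[i _ <-]|nGC] := pselect (G C); [exists i|exists i0].
have := Ec (map h s); apply: contra_not; apply: sub_finite_set => m Em C GC.
rewrite -(hP C GC); apply: Em => /=; apply: map_f.
by move: GC; rewrite Gs.
Qed.

(** [F] serves as index type, but [E] need not be its inclusion: if all centered families indexed by
    [F] had pseudobases, [F] would have a pseudo-intersection. *)
Theorem pseudobase_free_family :
  exists F, realizes_pseudo_intersection_number F /\
    exists E : F -> set nat, centered_family E /\ ~ countable_pseudobase E.
Proof.
have [F [[Fc Fpi] Fmin]] := min_card_exists no_pseudo_intersection_exists.
exists F; split; first by split.
apply: contrapT => /forallNP nE; apply: Fpi.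
have [|P [Pinf PF]] :=
    all_pseudobased_pseudo_intersection _ (centered_family_set Fc).
  by move=> E Ec; apply: contrapT => Epb; apply: (nE E).
exists P; split=> // B FB.
by have := PF (exist _ B (mem_set FB)).
Qed.

(** * Function spaces *)

Local Open Scope ring_scope.

Definition Cp_fun (X : topologicalType) (R : realType) (f : Cp X R) : X -> R :=
  set_val f.

Lemma Cp_fun_continuous (X : topologicalType) (R : realType) (f : Cp X R) :
  continuous (Cp_fun f).
Proof. exact: (set_valP f). Qed.

Lemma Cp_fun_inj (X : topologicalType) (R : realType) : injective (@Cp_fun X R).
Proof. exact: val_inj. Qed.

Lemma Cp_cvgP (X : topologicalType) (R : realType) (F : set_system (Cp X R))
    (FF : Filter F) (f : Cp X R) :
  F --> f <->
  forall x (e : R), 0 < e -> F [set g | `|Cp_fun f x - Cp_fun g x| < e].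
Proof.
split=> [Ff x e e0|Fe].
  have /pointwise_cvgP/(_ x)/cvgrPdist_lt/(_ e e0) :
      {ptws, (@Cp_fun X R) @ F --> Cp_fun f}.
    apply: cvg_trans (cvg_app _ Ff) _.
    exact: (@initial_continuous _ {ptws X -> R} set_val f).
  by [].
have ptw : {ptws, (@Cp_fun X R) @ F --> Cp_fun f}.
  apply/pointwise_cvgP => x; apply/cvgrPdist_lt => e e0; exact: Fe.
move=> A [_ [[B Bop <-] Bf BA]].
have : nbhs (Cp_fun f : {ptws X -> R}) B by apply: open_nbhs_nbhs.
by move=> /ptw FB; exact: filterS BA FB.
Qed.

(** The basic sets [W] generate a filter converging pointwise to [f], which therefore contains every
    neighborhood of [f]. *)
Lemma Cp_nbhsP (X : topologicalType) (R : realType) (f : Cp X R)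
    (U : set (Cp X R)) :
  nbhs f U <-> exists (s : seq X) (e : R), 0 < e /\
    forall g, (forall x, x \in s -> `|Cp_fun f x - Cp_fun g x| < e) -> U g.
Proof.
pose W (se : seq X * R) := [set g | forall x, x \in se.1 ->
  `|Cp_fun f x - Cp_fun g x| < se.2].
pose F := filter_from [set se : seq X * R | 0 < se.2] W.
have FF : Filter F.
  apply: filter_from_filter; first by exists ([::], 1) => /=.
  move=> [s d] [t e] /= d0 e0; exists (s ++ t, Num.min d e) => /=.
    by rewrite lt_min d0.
  move=> g gst; split=> x xs /=; have := gst x.
    by rewrite mem_cat xs lt_min => /(_ isT)/andP[].
  by rewrite mem_cat xs orbT lt_min => /(_ isT)/andP[].
have Ff : F --> f.
  apply/Cp_cvgP => x e e0; exists ([:: x], e) => //= g; apply.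
  by rewrite inE.
split=> [/Ff[[s e] /= e0 sU]|[s [e [e0 sU]]]]; first by exists s, e.
apply: filterS sU _.
have /Cp_cvgP nf : nbhs f --> f by [].
elim: s => [|x s IHs]; first exact: filterS filterT.
apply: filterS2 (nf x e e0) IHs => g gx gs z.
by rewrite inE => /predU1P[->|/gs].
Qed.

Lemma pointwise_sequence_pytkeev (X : topologicalType) (R : realType)
    (A : set (Cp X R)) (y : Cp X R) (f : nat -> Cp X R) :
  ~ A y -> (forall j, A (f j)) ->
  (forall x (e : R), 0 < e -> exists N, forall j, (N <= j)%N ->
     `|Cp_fun y x - Cp_fun (f j) x| < e) ->
  exists B : nat -> set (Cp X R),
    (forall n, B n `<=` A /\ infinite_set (B n)) /\
    (forall U, nbhs y U -> exists n, B n `<=` U).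
Proof.
move=> nAy Af fy; exists (fun n => [set f j | j in [set j | (n <= j)%N]]).
split=> [n|U /Cp_nbhsP[s [e [e0 sU]]]].
  split=> [_ [j _ <-]//|finB].
  have : infinite_set [set j | (n <= j)%N].
    apply/infinite_natP => m.
    by exists (maxn n m); rewrite /= ?leq_maxl ?leq_maxr.
  (* Each value differs from [y] at some point, so convergence there makes its fibre finite. *)
  apply; apply: (@sub_finite_set _ _
    (\bigcup_(v in [set f j | j in [set j | (n <= j)%N]]) [set j | f j = v])).
    by move=> j nj; exists (f j) => //; exists j.
  apply: bigcup_finite => // _ [i _ <-].
  have [x fx] : exists x, Cp_fun y x != Cp_fun (f i) x.
    apply: contrapT => nx; apply: nAy; suff -> : y = f i by [].
    apply: Cp_fun_inj; apply/funext => x; apply: contrapT => /eqP fx.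
    by apply: nx; exists x.
  have [|N fN] := fy x `|Cp_fun y x - Cp_fun (f i) x|.
    by rewrite normr_gt0 subr_eq0.
  apply: (@sub_finite_set _ _ `I_N); last exact: finite_II.
  move=> j /= fij; rewrite ltnNge; apply/negP => /fN.
  by rewrite fij ltxx.
suff [N fN] : exists N, forall j, (N <= j)%N -> forall x, x \in s ->
    `|Cp_fun y x - Cp_fun (f j) x| < e.
  by exists N => _ [j /= Nj <-]; apply: sU; exact: fN.
elim: s {sU} => [|x s [N fN]]; first by exists 0%N.
have [M fM] := fy x e e0; exists (maxn N M) => j.
rewrite geq_max => /andP[Nj Mj] z; rewrite inE => /predU1P[->|].
  exact: fM.
exact: fN.
Qed.

(** * Countable tightness and pseudo-intersections *)

(** A list of rational data asks for values within [d] of [c] between [p] and [q]. For each of the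
    countably many lists, the sequence picks a member of [A] obeying it, if there is one. *)
Lemma Cp_countable_tightness (R : realType) (Z : set R) (A : set (Cp Z R))
    (y : Cp Z R) :
  closure A y -> exists g : nat -> Cp Z R, (forall n, A (g n)) /\
    forall (s : seq Z) (e : R), 0 < e -> exists n, forall x, x \in s ->
      `|Cp_fun y x - Cp_fun (g n) x| < e.
Proof.
move=> clA.
have clP (s : seq Z) (e : R) : 0 < e -> exists f, A f /\
    forall x, x \in s -> `|Cp_fun y x - Cp_fun f x| < e.
  move=> e0; have [|f [Af fs]] := clA [set f | forall x, x \in s ->
      `|Cp_fun y x - Cp_fun f x| < e].
    by apply/Cp_nbhsP; exists s, e.
  by exists f.
have [a0 [Aa0 _]] := clP [::] 1 ltr01.
pose N (w : seq (rat * rat * rat * rat)) := [set f : Cp Z R | forall p q c d,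
  (p, q, c, d) \in w -> forall x : Z, ratr p < set_val x < ratr q ->
  `|Cp_fun f x - ratr c| < ratr d].
have /choice[g gP] w : exists g, A g /\ ((A `&` N w) !=set0 -> N w g).
  have [[g [Ag Ng]]|nN] := pselect ((A `&` N w) !=set0); first by exists g.
  by exists a0.
pose dec n : seq (rat * rat * rat * rat) := odflt [::] (unpickle n).
have decK w : dec (pickle w) = w by rewrite /dec pickleK.
exists (fun n => g (dec n)); split=> [n|s e e0]; first by have [] := gP (dec n).
have e30 : 0 < e / 3 by rewrite divr_gt0.
have [f [Af fs]] := clP s _ e30.
(* The final estimate adds [e / 3] from [y] to [f] and twice [d] via the value [c]. *)
have [d] := rat_in_itvoo e30; rewrite in_itv /= => /andP[d0 de].
have d20 : 0 < ratr d / 2 :> R by rewrite divr_gt0.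
have /choice[T TP] (x : Z) : exists t : rat * rat * rat * rat,
    [/\ ratr t.1.1.1 < set_val x < ratr t.1.1.2, t.2 = d,
      `|Cp_fun f x - ratr t.1.2| < ratr d &
      forall z : Z, ratr t.1.1.1 < set_val z < ratr t.1.1.2 ->
        `|Cp_fun f z - ratr t.1.2| < ratr d].
  have [c] := @rat_in_itvoo R (Cp_fun f x - ratr d / 2)
    (Cp_fun f x + ratr d / 2) ltac:(lra).
  rewrite in_itv /= => /andP[c1 c2].
  have /cvgrPdist_lt/(_ _ d20) := @Cp_fun_continuous _ _ f x.
  move=> [_ [[B Bop <-] /= Bx BP]].
  have /nbhs_ballP[r /= r0 rB] : nbhs (set_val x) B by apply: open_nbhs_nbhs.
  have [p] := @rat_in_itvoo R (set_val x - r) (set_val x) ltac:(lra).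
  rewrite in_itv /= => /andP[p1 p2].
  have [q] := @rat_in_itvoo R (set_val x) (set_val x + r) ltac:(lra).
  rewrite in_itv /= => /andP[q1 q2].
  exists (p, q, c, d); split=> //=; first by rewrite p2.
    by rewrite ltr_norml; apply/andP; split; lra.
  move=> z /andP[pz zq].
  have : `|Cp_fun f x - Cp_fun f z| < ratr d / 2.
    apply: BP; apply: rB; rewrite /= /ball /= ltr_norml.
    by apply/andP; split; lra.
  by rewrite !ltr_norml => /andP[z1 z2]; apply/andP; split; lra.
pose w := map T s.
have gN : N w (g w).
  have [_] := gP w; apply; exists f; split=> // p q c d' /mapP[x xs pq] z pzq.
  by have := TP x; rewrite -pq /= => -[_ -> _]; apply.
exists (pickle w) => x xs; rewrite decK.
have [xpq Td fc _] := TP x.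
have := gN (T x).1.1.1 (T x).1.1.2 (T x).1.2 (T x).2.
rewrite -!surjective_pairing => /(_ (map_f _ xs) x xpq); rewrite Td.
move: fc (fs x xs); rewrite !ltr_norml => /andP[? ?] /andP[? ?] /andP[? ?].
by apply/andP; split; lra.
Qed.

Lemma pseudo_intersection_pytkeev (R : realType) (Z : set R) :
  (forall E : Z -> set nat, centered_family E ->
     exists P, infinite_set P /\ forall i, almost_subset P (E i)) ->
  pytkeev (Cp Z R).
Proof.
move=> piZ A y [clA nAy].
have [g [Ag gy]] := Cp_countable_tightness clA.
have small (e : R) : 0 < e -> exists k, forall m, (k <= m)%N -> m.+1%:R^-1 < e.
  move=> e0; exists (Num.bound e^-1) => m km.
  rewrite invf_plt ?posrE//.
  have /archi_boundP/lt_le_trans : 0 <= e^-1 by rewrite invr_ge0 ltW.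
  by apply; rewrite ler_nat leqW.
have [finZ|/infiniteP/pcard_leP/unsquash z] := pselect (finite_set Z).
  have /finite_seqP[s Zs] : finite_set [set: Z].
    by rewrite (eq_finite_set (card_setT Z)).
  have /choice[h hP] j : exists n, forall x, x \in s ->
      `|Cp_fun y x - Cp_fun (g n) x| < j.+1%:R^-1.
    by apply: gy; rewrite invr_gt0.
  apply: (@pointwise_sequence_pytkeev _ _ A y (g \o h)) => //= x e /small[k ke].
  exists k => j /ke; apply: lt_trans; apply: hP.
  by have : [set: Z] x by []; rewrite Zs.
(* The clause on z makes q tend to infinity along a pseudo-intersection, and
   keeps Z as the index set. *)
pose dec c : nat * nat := odflt (0%N, 0%N) (unpickle c).
have decK nm : dec (pickle nm) = nm by rewrite /dec pickleK.
pose p c := (dec c).1; pose q c := (dec c).2.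
pose E (x : Z) := [set c : nat |
  `|Cp_fun y x - Cp_fun (g (p c)) x| < (q c).+1%:R^-1 /\
  forall k, z k = set_val x -> (k <= q c)%N].
have [s|P [/infinite_natP Pinf PE]] := piZ E.
  (* For every [m] from [M] on, some pair [(n, m)] is coded in the intersection, whose image under
     [q] is thus infinite. *)
  have [M MP] : exists M, forall k, z k \in map set_val s -> (k <= M)%N.
    elim: s => [|x s [M MP]]; first by exists 0%N.
    have [[k0 zk0]|nz] := pselect (exists k, z k = set_val x).
      exists (maxn k0 M) => k; rewrite inE leq_max => /predU1P[|/MP->].
        by rewrite -zk0 => /inj -> //; rewrite ?inE ?leqnn.
      by rewrite orbT.
    by exists M => k; rewrite inE => /predU1P[zk|/MP//]; case: nz; exists k.
  move=> finE.
  have : infinite_set [set m | (M <= m)%N].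
    apply/infinite_natP => m.
    by exists (maxn M m); rewrite /= ?leq_maxl ?leq_maxr.
  apply; apply: sub_finite_set (finite_image q finE) => m /= Mm.
  have [n ns] := gy s m.+1%:R^-1 ltac:(by rewrite invr_gt0).
  exists (pickle (n, m)); last by rewrite /q decK.
  move=> x xs; rewrite /E /p /q /= decK; split; first exact: ns.
  by move=> k zk; apply: leq_trans Mm; apply: MP; rewrite zk map_f.
have /choice[c cP] j : exists c, P c /\ (j <= c)%N.
  by have [c jc Pc] := Pinf j; exists c.
apply: (@pointwise_sequence_pytkeev _ _ A y (fun j => g (p (c j)))) => //.
move=> x e e0.
have [k ke] := small e e0.
have /almost_subsetP[N PN] := PE x.
have Zzk : Z (z k) by exact: funS.
pose zk : Z := exist _ (z k) (mem_set Zzk).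
have /almost_subsetP[M PM] := PE zk.
exists (maxn N M) => j; rewrite geq_max => /andP[Nj Mj].
have [Pc jc] := cP j.
have [yg _] := PN _ (leq_trans Nj jc) Pc.
have [_ /(_ k erefl) kq] := PM _ (leq_trans Mj jc) Pc.
exact: lt_trans yg (ke _ kq).
Qed.

Lemma not_pytkeev_family (R : realType) (Z : set R) :
  ~ pytkeev (Cp Z R) -> exists G : set (set nat),
    [/\ centered G, ~ exists A, pseudo_intersection G A & G #<= Z].
Proof.
move=> npZ; apply: contrapT => nG; apply: npZ.
apply: pseudo_intersection_pytkeev => E Ec; apply: contrapT => nP.
apply: nG; exists (range E); split; first exact: centered_range.
  move=> [P [Pinf PE]]; apply: nP; exists P; split=> // i.
  by apply: PE; exists i.
apply: card_le_trans (card_image_le _ _) _.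
by have /card_eqPle[] := card_setT Z.
Qed.

(** * Coding sets of naturals by reals *)

Definition ternary_sum (R : realType) (A : set nat) (n : nat) : R :=
  \sum_(i < n) (`[< A i >] : nat)%:R / 3 ^+ i.

Definition ternary (R : realType) (A : set nat) : R :=
  sup (range (ternary_sum R A)).

Lemma ternary_sumS (R : realType) (A : set nat) (n : nat) :
  ternary_sum R A n.+1 = ternary_sum R A n + (`[< A n >] : nat)%:R / 3 ^+ n.
Proof. by rewrite /ternary_sum big_ord_recr. Qed.

(** [3 / 2 / 3 ^+ m] sums all units from position [m] on; subtracting those from [m + k] on makes
    the induction work. *)
Lemma ternary_sum_le (R : realType) (A : set nat) (m k : nat) :
  ternary_sum R A m <= ternary_sum R A (m + k) <=
  ternary_sum R A m + 3 / 2 / 3 ^+ m - 3 / 2 / 3 ^+ (m + k).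
Proof.
elim: k => [|k /andP[IH1 IH2]]; first by rewrite addn0 addrK !lexx.
rewrite addnS ternary_sumS.
have p3 : 0 < (3 ^+ (m + k))^-1 :> R by rewrite invr_gt0 exprn_gt0.
rewrite (exprS _ (m + k)) invfM.
by case: asboolP => _ /=; apply/andP; split; lra.
Qed.

Lemma ternary_bounds (R : realType) (A : set nat) (m : nat) :
  ternary_sum R A m <= ternary R A <= ternary_sum R A m + 3 / 2 / 3 ^+ m.
Proof.
have ub : ubound (range (ternary_sum R A)) (ternary_sum R A m + 3 / 2 / 3 ^+ m).
  move=> _ [n _ <-].
  have p3 k : 0 < (3 ^+ k)^-1 :> R by rewrite invr_gt0 exprn_gt0.
  have [nm|mn] := leqP n m.
    have := ternary_sum_le R A n (m - n); rewrite subnKC // => /andP[+ _].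
    by have := p3 m; lra.
  have := ternary_sum_le R A m (n - m).
  rewrite subnKC ?(ltnW mn) // => /andP[_].
  by have := p3 n; lra.
apply/andP; split.
  apply: ub_le_sup; last by exists m.
  by exists (ternary_sum R A m + 3 / 2 / 3 ^+ m).
by apply: ge_sup => //; exists (ternary_sum R A 0), 0%N.
Qed.

(** Earlier digits agree by strong induction. A difference at [n] contributes a full unit, of which
    later digits can cancel at most half. *)
Lemma ternary_dist (R : realType) (A B : set nat) (n : nat) :
  `|ternary R A - ternary R B| < (3 ^+ n)^-1 / 2 -> A n <-> B n.
Proof.
have [n0] := ubnP n; elim: n0 n A B => // n0 IH n A B nn0 AB.
have sAB : ternary_sum R A n = ternary_sum R B n.
  apply: eq_bigr => i _; congr (_%:R / _); congr nat_of_bool.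
  apply/asbool_equiv_eq; apply: IH; first exact: leq_trans (ltn_ord i) nn0.
  apply: lt_le_trans AB _; apply: ler_wpM2r; first by rewrite invr_ge0 ler0n.
  rewrite lef_pV2 ?posrE; [|by rewrite exprn_gt0 ?ltr0n..].
  by apply: ler_weXn2l; [rewrite ler1n|exact: ltnW].
have p3 : 0 < (3 ^+ n)^-1 :> R by rewrite invr_gt0 exprn_gt0.
have bA := ternary_bounds R A n.+1; have bB := ternary_bounds R B n.+1.
move: bA bB AB; rewrite !ternary_sumS sAB exprS invfM ltr_norml.
move: (ternary R A) (ternary R B) (ternary_sum R B n) ((3 ^+ n)^-1) p3.
move=> a b t u u0 /andP[a1 a2] /andP[b1 b2] /andP[c1 c2].
case: asboolP a1 a2 => nA /= a1 a2; case: asboolP b1 b2 => nB /= b1 b2 //.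
  by exfalso; lra.
by exfalso; lra.
Qed.

Lemma ternary_inj (R : realType) : injective (@ternary R).
Proof.
move=> A B AB; apply/funext => n; apply/propext/(@ternary_dist R).
by rewrite AB subrr normr0 divr_gt0 ?invr_gt0 ?exprn_gt0.
Qed.

Lemma pseudobase_free_not_pytkeev (R : realType) (I : choiceType)
    (E : I -> set nat) :
  centered_family E -> ~ countable_pseudobase E ->
  ~ pytkeev (Cp (range (ternary R \o E)) R).
Proof.
move=> Ec nE pyt; apply: nE; set X := range (ternary R \o E) in pyt *.
have [[i0 _]|I0] := pselect ([set: I] !=set0); last first.
  exists (fun=> setT); split=> [_|s]; first exact: infinite_nat.
  by exists 0%N => n _ j _; case: I0; exists j.
have /choice[h hP] (x : X) : exists i, ternary R (E i) = set_val x.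
  by have [i _ ix] := set_valP x; exists i.
(* The vanishing positive term keeps 0 out of the range of [f] but in its closure; a value below 1
   forces [n] into [E (h x)]. *)
pose a n (x : X) : R := (~~ `[< E (h x) n >] : nat)%:R + n.+2%:R^-1.
have ctsa n : continuous (a n : X -> R).
  move=> x; have e0 : 0 < (3 ^+ n)^-1 / 2 :> R.
    by rewrite divr_gt0 ?invr_gt0 ?exprn_gt0.
  have /cvgrPdist_lt/(_ _ e0) near_x : set_val @ x --> set_val x.
    exact: (@initial_continuous X R set_val x).
  have ax : \forall z \near x, a n z = a n x.
    (* Codes this close share the digit [n], so [a n] is locally constant. *)
    have sub (z : X) :
        `|set_val x - set_val z| < (3 ^+ n)^-1 / 2 -> a n z = a n x.
      rewrite -!hP => dxz; have xz := ternary_dist dxz; rewrite /a.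
      congr (_%:R + _); congr (nat_of_bool (~~ _)).
      by apply/asbool_equiv_eq; split => /xz.
    exact: filterS sub near_x.
  exact: cvg_near_cst ax.
pose f n : Cp X R := exist _ (a n : {ptws X -> R}) (mem_set (ctsa n)).
have cts0 : continuous ((fun=> 0) : X -> R) by exact: cst_continuous.
pose f0 : Cp X R := exist _ ((fun=> 0) : {ptws X -> R}) (mem_set cts0).
have inX i : X (ternary R (E i)) by exists i.
pose pt i : X := exist _ (ternary R (E i)) (mem_set (inX i)).
(* [h (pt i)] may differ from [i], but has the same code. *)
have hpt i : E (h (pt i)) = E i by apply: (@ternary_inj R); rewrite hP.
have fE n x : Cp_fun (f n) x = a n x by [].
have f0E x : Cp_fun f0 x = 0 by [].
have a0 n x : 0 < a n x by rewrite /a ltr_wpDl ?invr_gt0.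
have [|B [BP BU]] := pyt (range f) f0.
  split; last first.
    move=> [n _ /(congr1 (fun g => Cp_fun g (pt i0)))]; rewrite fE f0E => fn.
    by have := a0 n (pt i0); rewrite fn ltxx.
  move=> U /Cp_nbhsP[s [e [e0 sU]]].
  have /infinite_natP/(_ (Num.bound e^-1))[n en En] := Ec (map h s).
  exists (f n); split; first by exists n.
  apply: sU => x xs; rewrite f0E fE sub0r normrN gtr0_norm // /a.
  have -> : `[< E (h x) n >] = true.
    by apply/asboolP; apply: En; rewrite /= map_f.
  rewrite /= add0r invf_plt ?posrE//.
  have /archi_boundP/lt_le_trans : 0 <= e^-1 by rewrite invr_ge0 ltW.
  by apply; rewrite ler_nat -addn2 ltn_addr.
exists (fun k => [set n | B k (f n)]); split=> [k|s].
  have [Bf Binf] := BP k; apply: contra_not Binf => finB.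
  apply: sub_finite_set (finite_image f finB) => g Bg.
  by have [n _ fn] := Bf _ Bg; exists n => //=; rewrite fn.
have [|k Bk] := BU [set g | forall x, x \in map pt s ->
    `|Cp_fun f0 x - Cp_fun g x| < 1].
  by apply/Cp_nbhsP; exists (map pt s), 1.
exists k => n /Bk /= fn i /= si.
have := fn (pt i) (map_f pt si).
rewrite f0E fE sub0r normrN gtr0_norm // /a hpt.
by case: asboolP => //= _; rewrite gtrDl invr_lt0 ltNge ler0n.
Qed.

Theorem theorem3 (R : realType) :
  exists (X : set R) (F : set (set nat)),
    [/\ realizes_min_card (fun Z : set R => ~ pytkeev (Cp Z R)) X,
        realizes_pseudo_intersection_number F
      & X #= F].
Proof.
have [F [FP [E [Ec nE]]]] := pseudobase_free_family.
pose X := range (ternary R \o E).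
have npX : ~ pytkeev (Cp X R) := pseudobase_free_not_pytkeev Ec nE.
(* Minimality of [F] bounds every such [Z] from below; [X], an image of [F], attains the bound. *)
have Fle (Z : set R) : ~ pytkeev (Cp Z R) -> F #<= Z.
  move=> /not_pytkeev_family[G [Gc Gpi GZ]]; apply: card_le_trans GZ.
  exact: FP.2.
have XF : X #<= F.
  apply: card_le_trans (card_image_le _ _) _.
  by have /card_eqPle[] := card_setT F.
exists X, F; split=> //; last by apply/card_eqPle; split=> //; exact: Fle.
by split=> // Z /Fle; exact: card_le_trans.
Qed.
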